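(* Let $C$ be a (nonempty) completely pseudo-regular code in a finite simple connected graph $\Gamma$, with eccentricity $\varepsilon_C$ and subconstituents $C_0,C_1,\ldots,C_{\varepsilon_C}$. Then for every $k=0,1,\ldots,\varepsilon_C-1$, $$\mathrm{ev}_{C}\Gamma=\mathrm{ev}_{C_k}\Gamma\cup\mathrm{ev}_{C_{k+1}}\Gamma.$$
   Context: $\Gamma=(V,E)$ is a finite simple connected graph with vertex set $V=\{1,\ldots,n\}$, adjacency matrix $\boldsymbol{A}$ and distance function $\partial$; $\Gamma(i)$ is the set of neighbours of vertex $i$. The distinct eigenvalues of $\boldsymbol{A}$ are $\lambda_0>\lambda_1>\cdots>\lambda_d$, with eigenspaces $\mathcal{E}_l=\ker(\boldsymbol{A}-\lambda_l\boldsymbol{I})$, and $\boldsymbol{E}_l$ is the orthogonal projection of $\mathbb{R}^n$ onto $\mathcal{E}_l$. The vector $\boldsymbol{\nu}=(\nu_1,\ldots,\nu_n)\in\mathcal{E}_0$ is the unique positive eigenvector with minimum component equal to $1$. The vectors $\boldsymbol{e}_i$ are the coordinate vectors of $\mathbb{R}^n$. For nonempty $S\subset V$, $\boldsymbol{\rho}S:=\sum_{i\in S}\nu_i\boldsymbol{e}_i$ and $\boldsymbol{e}_S:=\boldsymbol{\rho}S/\|\boldsymbol{\rho}S\|$. The $S$-multiplicity of $\lambda_l$ is $m_S(\lambda_l):=\|\boldsymbol{E}_l\boldsymbol{e}_S\|^2$, and $\mathrm{ev}_S\Gamma$ is the set of eigenvalues of $\boldsymbol{A}$ with nonzero $S$-multiplicity.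 For a vertex $i$, $\partial(i,C)=\min_{j\in C}\partial(i,j)$; the eccentricity of $C$ is $\varepsilon_C=\max_{i\in V}\partial(i,C)$; the subconstituents associated to $C$ are the sets $C_k=\{i\in V:\partial(i,C)=k\}$, $0\le k\le\varepsilon_C$. For $i\in C_k$ put $c(i)=\frac1{\nu_i}\sum_{j\in\Gamma(i)\cap C_{k-1}}\nu_j$ (and $c(i)=0$ if $k=0$), $a(i)=\frac1{\nu_i}\sum_{j\in\Gamma(i)\cap C_k}\nu_j$, $b(i)=\frac1{\nu_i}\sum_{j\in\Gamma(i)\cap C_{k+1}}\nu_j$ (and $b(i)=0$ if $k=\varepsilon_C$). The set $C$ is a completely pseudo-regular code if, for every $k$, the values $c(i),a(i),b(i)$ are the same for all $i\in C_k$. *)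

(* Defs.v *)
From HB Require Import structures.
From mathcomp Require Import all_boot all_order all_algebra.

Set Implicit Arguments.
Unset Strict Implicit.
Unset Printing Implicit Defensive.
Import Order.TTheory GRing.Theory Num.Theory.
Local Open Scope ring_scope.

(* A graph on the vertices 'I_n is a symmetric irreflexive relation e.
   Vectors of R^n are row vectors, on which matrices act on the right; as the
   adjacency matrix is symmetric, its row eigenspaces are the transposes of
   its column eigenspaces. *)

Definition adjmx (R : pzSemiRingType) n (e : rel 'I_n) : 'M[R]_n :=
  \matrix_(i, j) (e i j)%:R.

Definition walk n (e : rel 'I_n) (m : nat) (x y : 'I_n) : bool :=
  [exists p : m.-tuple 'I_n, path e x p && (last x p == y)].

(* Distances in a connected graph on n vertices are smaller than n; the
   default value n stands for infinity. *)
Definition dist n (e : rel 'I_n) (x y : 'I_n) : nat :=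
  \big[minn/n]_(m < n | walk e m x y) m.

Definition dist_set n (e : rel 'I_n) (x : 'I_n) (C : {set 'I_n}) : nat :=
  \big[minn/n]_(y in C) dist e x y.

Definition eccentricity n (e : rel 'I_n) (C : {set 'I_n}) : nat :=
  \max_(x < n) dist_set e x C.

Definition subconstituent n (e : rel 'I_n) (C : {set 'I_n}) (k : nat) :
    {set 'I_n} :=
  [set x | dist_set e x C == k].

Definition perron_vector (R : rcfType) n (e : rel 'I_n) (nu : 'rV[R]_n) : Prop :=
  exists2 l0 : R,
    eigenvalue (adjmx R e) l0 /\
      (forall l, eigenvalue (adjmx R e) l -> l <= l0) &
    [/\ (nu <= eigenspace (adjmx R e) l0)%MS,
        forall i, 0 < nu 0 i,
        forall i, 1 <= nu 0 i &
        exists i, nu 0 i = 1].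

Definition vnorm (R : rcfType) n (v : 'rV[R]_n) : R :=
  Num.sqrt (\sum_i v 0 i ^+ 2).

(* Same construction as spectral.proj_ortho, which is restricted to
   numClosedFieldType. *)
Definition orthproj (R : rcfType) m n (U : 'M[R]_(m, n)) : 'M[R]_n :=
  proj_mx <<U>>%MS (orthomx idfun 1%:M U).

Definition eigenproj (R : rcfType) n (e : rel 'I_n) (l : R) : 'M[R]_n :=
  orthproj (eigenspace (adjmx R e) l).

Definition rho (R : rcfType) n (nu : 'rV[R]_n) (S : {set 'I_n}) : 'rV[R]_n :=
  \sum_(i in S) nu 0 i *: delta_mx 0 i.

Definition unitvec (R : rcfType) n (nu : 'rV[R]_n) (S : {set 'I_n}) :
    'rV[R]_n :=
  (vnorm (rho nu S))^-1 *: rho nu S.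

Definition set_mult (R : rcfType) n (e : rel 'I_n) (nu : 'rV[R]_n)
    (S : {set 'I_n}) (l : R) : R :=
  vnorm (unitvec nu S *m eigenproj e l) ^+ 2.

Definition ev (R : rcfType) n (e : rel 'I_n) (nu : 'rV[R]_n)
    (S : {set 'I_n}) : {pred R} :=
  [pred l | eigenvalue (adjmx R e) l && (set_mult e nu S l != 0)].

Definition wdeg (R : rcfType) n (e : rel 'I_n) (nu : 'rV[R]_n)
    (S : {set 'I_n}) (i : 'I_n) : R :=
  (nu 0 i)^-1 * \sum_(j | e i j && (j \in S)) nu 0 j.

Definition c_num (R : rcfType) n (e : rel 'I_n) (nu : 'rV[R]_n)
    (C : {set 'I_n}) (i : 'I_n) : R :=
  if dist_set e i C is k.+1 then wdeg e nu (subconstituent e C k) i else 0.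

Definition a_num (R : rcfType) n (e : rel 'I_n) (nu : 'rV[R]_n)
    (C : {set 'I_n}) (i : 'I_n) : R :=
  wdeg e nu (subconstituent e C (dist_set e i C)) i.

Definition b_num (R : rcfType) n (e : rel 'I_n) (nu : 'rV[R]_n)
    (C : {set 'I_n}) (i : 'I_n) : R :=
  if dist_set e i C == eccentricity e C then 0
  else wdeg e nu (subconstituent e C (dist_set e i C).+1) i.

Definition completely_pseudo_regular (R : rcfType) n (e : rel 'I_n)
    (nu : 'rV[R]_n) (C : {set 'I_n}) : Prop :=
  forall k, (k <= eccentricity e C)%N ->
  {in subconstituent e C k &, forall i j,
    [/\ c_num e nu C i = c_num e nu C j,
        a_num e nu C i = a_num e nu C j &
        b_num e nu C i = b_num e nu C j]}.

(* Main.v *)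
Require Import Defs.
From mathcomp Require Import all_boot all_order all_algebra.
From mathcomp Require Import zify.

(** Write r_k for the weighted indicator vector [rho nu C_k] of the k-th
    subconstituent.  Complete pseudo-regularity says that the partition of the
    vertices into C_0, ..., C_ecc is equitable for the weights nu, so that the
    span of r_0, ..., r_ecc is invariant under the adjacency matrix A
    ([rho_mul_adjmx]).  Since distances to C of adjacent vertices differ by at
    most one, A acts on this span by a tridiagonal matrix
    ([wdeg_far]); since every shortest walk to C crosses each intermediate
    subconstituent, the entries next to the diagonal are positive
    ([quotient_coef_gt0]).

    The projection E_l onto the l-eigenspace of the symmetric matrix A
    satisfies A E_l = l E_l ([orthproj_eigenspace]), so the vectors
    z_k = r_k E_l obey a three-term recurrence
      l z_k = b z_(k-1) + a z_k + c z_(k+1),   with b and c nonzero,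
    where z_(-1) = z_(ecc+1) = 0.  If z_0 = 0 then all z_k vanish, by going up;
    if z_k = z_(k+1) = 0 then z_0 = 0, by going down.  As l belongs to the
    spectrum of a set S exactly when [rho nu S] E_l is nonzero
    ([set_mult_eq0]), these two implications are the two inclusions. *)

Set Implicit Arguments.
Unset Strict Implicit.
Unset Printing Implicit Defensive.
Import Order.TTheory GRing.Theory Num.Theory.
Local Open Scope ring_scope.

(** * Walks and distances *)

Section Distance.
Variables (n : nat) (e : rel 'I_n).
Implicit Types (x y z : 'I_n) (C : {set 'I_n}).

Lemma walkP m x y :
  reflect (exists p, [/\ size p = m, path e x p & last x p = y]) (walk e m x y).
Proof.
apply: (iffP existsP) => [[p /andP[ep /eqP lp]]|[p [sp ep lp]]].
  by exists p; rewrite size_tuple.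
have spT : size p == m by apply/eqP.
by exists (Tuple spT); rewrite /= ep lp eqxx.
Qed.

Lemma walk0 x y : walk e 0 x y = (x == y).
Proof.
apply/walkP/eqP => [[p [/size0nil-> _ <-]] //|<-].
by exists [::].
Qed.

Lemma walkS m x z : reflect (exists2 y, e x y & walk e m y z) (walk e m.+1 x z).
Proof.
apply: (iffP (walkP _ _ _)) => [[[|y p] [//= [sp] /andP[exy ep] lp]]|].
  by exists y => //; apply/walkP; exists p.
move=> [y exy /walkP[p [sp ep lp]]].
by exists (y :: p); rewrite /= sp exy.
Qed.

Lemma dist_le_card x y : (dist e x y <= n)%N.
Proof. by rewrite /dist -minEnat -leEnat bigmin_le_id. Qed.

Lemma dist_le m x y : walk e m x y -> (dist e x y <= m)%N.
Proof.
move=> w; have [lt_mn|le_nm] := ltnP m n; last first.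
  exact: leq_trans (dist_le_card x y) le_nm.
rewrite /dist -minEnat -leEnat.
exact: (@bigmin_le_cond _ _ _ _ (Ordinal lt_mn)).
Qed.

(** In a connected graph the default value of the distance is never taken: a
    walk without repeated vertices has fewer than n steps. *)
Lemma walk_dist x y : connect e x y -> walk e (dist e x y) x y.
Proof.
case/connectP=> p ep ->; case: (shortenP ep) => q eq uq _ {p ep}.
have lt_qn : (size q < n)%N.
  by have := card_uniqP uq; rewrite /= => <-; rewrite -[X in (_ <= X)%N]card_ord max_card.
have w : walk e (Ordinal lt_qn) x (last x q) by apply/walkP; exists q.
rewrite /dist -minEnat (bigmin_eq_arg _ (Ordinal lt_qn)) //=.
  by case: arg_minP.
by move=> i _; rewrite leEnat ltnW.
Qed.

Lemma dist_set_le C m x y : y \in C -> walk e m x y -> (dist_set e x C <= m)%N.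
Proof.
move=> yC /dist_le; apply: leq_trans.
rewrite /dist_set -minEnat -leEnat.
exact: (@bigmin_le_cond _ _ _ _ y).
Qed.

Hypothesis e_conn : forall x y, connect e x y.
Variable C : {set 'I_n}.
Hypothesis C_neq0 : C != set0.

Lemma walk_dist_set x : exists2 y, y \in C & walk e (dist_set e x C) x y.
Proof.
have [y0 y0C] := set0Pn _ C_neq0.
rewrite /dist_set -minEnat (bigmin_eq_arg _ y0) //=.
  by case: arg_minP => // y yC _; exists y; rewrite // walk_dist.
by move=> i _; rewrite leEnat dist_le_card.
Qed.

Lemma dist_set_edge x y : e x y -> (dist_set e x C <= (dist_set e y C).+1)%N.
Proof.
move=> exy; have [z zC w] := walk_dist_set y.
by apply: (dist_set_le zC); apply/walkS; exists y.
Qed.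

Lemma subconstituent0 : subconstituent e C 0 = C.
Proof.
apply/setP => x; rewrite inE -leqn0; apply/idP/idP => [|xC].
  by rewrite leqn0 => /eqP d0; have [y yC] := walk_dist_set x; rewrite d0 walk0 => /eqP->.
by apply: (dist_set_le xC); rewrite walk0.
Qed.

Lemma subconstituent_pred k x : x \in subconstituent e C k.+1 ->
  exists2 y, e x y & y \in subconstituent e C k.
Proof.
rewrite inE => /eqP dx; have [z zC] := walk_dist_set x.
rewrite dx => /walkS[y exy w]; exists y => //.
have := dist_set_edge exy; have := dist_set_le zC w.
by rewrite inE dx; lia.
Qed.

(** A vertex at maximal distance from C reaches C by a shortest walk that meets
    every subconstituent. *)
Lemma subconstituent_neq0 k : (k <= eccentricity e C)%N ->
  exists x, x \in subconstituent e C k.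
Proof.
move=> /subnKC; move: (_ - _)%N => m; elim: m k => [|m IHm] k km; last first.
  have [|x /subconstituent_pred[y _ yk]] := IHm k.+1; first by rewrite -km; lia.
  by exists y.
have [x0 _] := set0Pn _ C_neq0.
have [|x xE] := bigop.eq_bigmax (fun x => dist_set e x C).
  by apply/card_gt0P; exists x0.
by exists x; rewrite inE -xE -/(eccentricity e C) -km addn0.
Qed.

Lemma dist_set_ecc x : (dist_set e x C <= eccentricity e C)%N.
Proof. exact: (leq_bigmax x). Qed.

End Distance.

(** * Orthogonal projections onto eigenspaces *)

Section Projection.
Variables (R : rcfType) (n : nat).

Lemma vnorm_eq0 (v : 'rV[R]_n) : (vnorm v == 0) = (v == 0).
Proof.
have sq_ge0 i : 0 <= v 0 i ^+ 2 by rewrite sqr_ge0.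
have sum_ge0 : 0 <= \sum_i v 0 i ^+ 2 by apply: sumr_ge0 => i _.
rewrite /vnorm sqrtr_eq0 le_eqVlt ltNge sum_ge0 orbF psumr_eq0 => [|i _] //.
apply/allP/eqP => [v0|-> i _]; last by rewrite mxE expr0n eqxx.
apply/rowP => i; rewrite mxE; apply/eqP; rewrite -sqrf_eq0.
exact: v0 (mem_index_enum i).
Qed.

Lemma orthomx_kermx m (U : 'M[R]_(m, n)) : orthomx idfun 1%:M U = kermx U^T.
Proof.
rewrite /orthomx mul1mx; congr kermx.
by apply/matrixP => i j; rewrite !mxE.
Qed.

Lemma sub_orthomx m p (U : 'M[R]_(m, n)) (W : 'M[R]_(p, n)) :
  (W <= orthomx idfun 1%:M U)%MS = (W *m U^T == 0).
Proof. by rewrite orthomx_kermx sub_kermx. Qed.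

(** Over a real field a vector orthogonal to itself is zero. *)
Lemma cap_orthomx m (U : 'M[R]_(m, n)) :
  (<<U>> :&: orthomx idfun 1%:M U = 0)%MS.
Proof.
apply/eqP; rewrite -submx0; apply/rV_subP => v.
rewrite sub_capmx genmxE sub_orthomx => /andP[/submxP[a vE] /eqP vU].
rewrite submx0 -vnorm_eq0 /vnorm (_ : \sum_i _ = (v *m v^T) 0 0).
  by rewrite [in v^T]vE trmx_mul mulmxA vU mul0mx mxE sqrtr0.
by rewrite mxE; apply: eq_bigr => i _; rewrite mxE expr2.
Qed.

Lemma add_orthomx m (U : 'M[R]_(m, n)) :
  row_full (<<U>> + orthomx idfun 1%:M U)%MS.
Proof.
rewrite /row_full (mxrank_disjoint_sum (cap_orthomx U)) genmxE.
by rewrite orthomx_kermx mxrank_ker mxrank_tr subnKC // rank_leq_col.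
Qed.

(** The orthogonal complement of an eigenspace of a symmetric matrix is stable,
    so that the projection commutes with the matrix, which acts on the image as
    the scalar l. *)
Lemma orthproj_eigenspace (A : 'M[R]_n) l (v : 'rV[R]_n) : A^T = A ->
  v *m A *m orthproj (eigenspace A l) = l *: (v *m orthproj (eigenspace A l)).
Proof.
move=> A_sym; rewrite /orthproj; set U := eigenspace A l; set P := proj_mx _ _.
have vP : (v *m P <= U)%MS by rewrite -(genmxE U) proj_mx_sub.
have vPA : v *m P *m A = l *: (v *m P) by apply/eigenspaceP.
have UA : U *m A = l *: U by apply/eigenspaceP.
have vQ : (v - v *m P <= orthomx idfun 1%:M U)%MS.
  by apply: proj_mx_compl_sub; rewrite submx_full ?add_orthomx.
have vQA : ((v - v *m P) *m A <= orthomx idfun 1%:M U)%MS.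
  move: vQ; rewrite !sub_orthomx => /eqP vQ.
  by rewrite -mulmxA -{1}A_sym -trmx_mul UA linearZ -scalemxAr vQ scaler0.
rewrite -{1}(subrK (v *m P) v) mulmxDl mulmxDl proj_mx_0 ?cap_orthomx // add0r.
by rewrite vPA -scalemxAl proj_mx_id ?cap_orthomx ?genmxE.
Qed.

Lemma adjmx_sym (e : rel 'I_n) : symmetric e -> (adjmx R e)^T = adjmx R e.
Proof. by move=> e_sym; apply/matrixP => i j; rewrite !mxE e_sym. Qed.

Lemma set_mult_eq0 (e : rel 'I_n) (nu : 'rV[R]_n) S l :
  (set_mult e nu S l == 0) = (rho nu S *m eigenproj e l == 0).
Proof.
rewrite /set_mult sqrf_eq0 vnorm_eq0 /unitvec -scalemxAl scaler_eq0 invr_eq0.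
by rewrite vnorm_eq0; have [->|_] := eqVneq; rewrite // mul0mx eqxx.
Qed.

End Projection.

(** * The quotient matrix of a completely pseudo-regular code *)

Section Quotient.
Variables (R : rcfType) (n : nat) (e : rel 'I_n) (nu : 'rV[R]_n).
Hypothesis e_sym : symmetric e.
Hypothesis e_conn : forall x y : 'I_n, connect e x y.
Hypothesis nu_gt0 : forall i, 0 < nu 0 i.
Variable C : {set 'I_n}.
Hypothesis C_neq0 : C != set0.
Local Notation ecc := (eccentricity e C).
Local Notation C_ := (subconstituent e C).

Lemma rhoE S i : rho nu S 0 i = if i \in S then nu 0 i else 0.
Proof.
have entry j : (nu 0 j *: delta_mx 0 j : 'rV_n) 0 i = nu 0 j * (i == j)%:R.
  by rewrite !mxE.
rewrite /rho summxE; case: ifPn => iS.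
  rewrite (bigD1 i) //= entry eqxx mulr1 big1 ?addr0 // => j /andP[_ ji].
  by rewrite entry eq_sym (negPf ji) mulr0.
rewrite big1 // => j jS; rewrite entry; case: eqP => [ij|_]; last exact: mulr0.
by rewrite ij jS in iS.
Qed.

Lemma wdeg_gt0 (S : {set 'I_n}) i j : e i j -> j \in S -> 0 < wdeg e nu S i.
Proof.
move=> eij jS; rewrite mulr_gt0 ?invr_gt0 //.
rewrite (bigD1 j) ?eij //= ltr_wpDr // sumr_ge0 // => k _.
exact: ltW.
Qed.

(** Adjacent vertices have distances to C that differ by at most one. *)
Lemma wdeg_far k i : (k.+1 < dist_set e i C)%N || ((dist_set e i C).+1 < k)%N ->
  wdeg e nu (C_ k) i = 0.
Proof.
move=> far; rewrite /wdeg big_pred0 ?mulr0 // => j; rewrite inE.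
apply/negP => /andP[eij /eqP dj]; have := dist_set_edge e_conn C_neq0 eij.
by rewrite e_sym in eij; have := dist_set_edge e_conn C_neq0 eij; lia.
Qed.

(** The numbers c, a and b of the definition are the weighted degrees into C_k
    for k = m - 1, m, m + 1; the degrees into the other subconstituents are 0. *)
Lemma wdeg_const k m : completely_pseudo_regular e nu C ->
  (k <= ecc)%N -> (m <= ecc)%N ->
  {in C_ m &, forall i j, wdeg e nu (C_ k) i = wdeg e nu (C_ k) j}.
Proof.
move=> cpr k_le m_le i j im jm; have [] := cpr m m_le i j im jm.
move: im jm; rewrite /c_num /a_num /b_num !inE => /eqP di /eqP dj.
rewrite di dj => c_eq a_eq b_eq.
have [mk|km|<- //] := ltngtP m k.
  have [kE|k_neq] := eqVneq k m.+1; last by rewrite !wdeg_far ?di ?dj //; lia.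
  by move: b_eq; rewrite kE; case: eqP => //; lia.
have [mE|m_neq] := eqVneq m k.+1; last by rewrite !wdeg_far ?di ?dj //; lia.
by move: c_eq; rewrite mE.
Qed.

(** The common value of [wdeg e nu (C_ k)] on C_m, read off at an arbitrary
    vertex of C_m. *)
Definition quotient_coef k m : R :=
  if [pick i in C_ m] is Some i then wdeg e nu (C_ k) i else 0.

Lemma quotient_coefE k m i : completely_pseudo_regular e nu C ->
  (k <= ecc)%N -> (m <= ecc)%N -> i \in C_ m ->
  quotient_coef k m = wdeg e nu (C_ k) i.
Proof.
move=> cpr k_le m_le im; rewrite /quotient_coef.
by case: pickP => [j jm|/(_ i)]; [exact: (wdeg_const cpr k_le m_le)|rewrite im].
Qed.

Lemma quotient_coef_far k m : (k.+1 < m)%N || (m.+1 < k)%N ->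
  quotient_coef k m = 0.
Proof.
move=> far; rewrite /quotient_coef; case: pickP => // i; rewrite inE => /eqP di.
by apply: wdeg_far; rewrite di.
Qed.

(** Each vertex of C_(k+1) has a neighbour in C_k.  The coefficient for the
    pair (C_k, C_(k+1)) is positive for this reason, and so is the one for
    (C_(k+1), C_k) because the neighbour has that vertex as a neighbour. *)
Lemma quotient_coef_gt0 k m : completely_pseudo_regular e nu C ->
  (k <= ecc)%N -> (m <= ecc)%N -> (k == m.+1) || (m == k.+1) ->
  0 < quotient_coef k m.
Proof.
move=> cpr k_le m_le /orP[/eqP kE|/eqP mE].
  have [i ik] := subconstituent_neq0 e_conn C_neq0 k_le.
  have [||j eij jm] := @subconstituent_pred _ e e_conn C _ m i; rewrite -?kE //.
  rewrite (quotient_coefE cpr k_le m_le jm).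
  by apply: (wdeg_gt0 (j := i)); rewrite // e_sym.
have [i im] := subconstituent_neq0 e_conn C_neq0 m_le.
have [||j eij jk] := @subconstituent_pred _ e e_conn C _ k i; rewrite -?mE //.
rewrite (quotient_coefE cpr k_le m_le im).
exact: (wdeg_gt0 (j := j)).
Qed.

(** At a vertex j of C_m, the product [rho nu (C_ k) *m A] takes the value
    [nu 0 j * wdeg e nu (C_ k) j], which is the j-th entry of
    [quotient_coef k m *: rho nu (C_ m)]. *)
Lemma rho_mul_adjmx k : completely_pseudo_regular e nu C -> (k <= ecc)%N ->
  rho nu (C_ k) *m adjmx R e =
  \sum_(m < ecc.+1) quotient_coef k m *: rho nu (C_ m).
Proof.
move=> cpr k_le; apply/rowP => j; rewrite mxE summxE.
have dj_le : (dist_set e j C < ecc.+1)%N by rewrite ltnS dist_set_ecc.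
rewrite (bigD1 (Ordinal dj_le)) //= [X in _ + X]big1 => [|m m_neq]; last first.
  rewrite mxE rhoE inE; case: eqP => [dj|_]; last exact: mulr0.
  by case/eqP: m_neq; apply: val_inj.
have jC : j \in C_ (dist_set e j C) by rewrite inE.
rewrite addr0 mxE rhoE jC (quotient_coefE cpr k_le _ jC) // mulrC /wdeg.
rewrite mulVKf ?gt_eqF // [RHS]big_mkcond /=; apply: eq_bigr => i _.
rewrite rhoE !mxE e_sym.
by case: (e j i); case: (i \in _); rewrite ?mulr1 ?mulr0 ?mul0r.
Qed.

(** ** The recurrence between the projections of the subconstituents *)

Hypothesis C_cpr : completely_pseudo_regular e nu C.
Variable l : R.
Local Notation z k := (rho nu (C_ k) *m eigenproj e l).

Lemma proj_recurrence k : (k <= ecc)%N ->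
  l *: z k = \sum_(m < ecc.+1) quotient_coef k m *: z m.
Proof.
move=> k_le; rewrite -(orthproj_eigenspace _ _ (adjmx_sym R e_sym)).
rewrite rho_mul_adjmx // mulmx_suml.
by apply: eq_bigr => m _; rewrite -scalemxAl.
Qed.

(** In the recurrence at k only the projections at k - 1, k and k + 1 occur.
    Those at k - 1 and k + 1 have nonzero coefficients, so each is determined by
    the two other projections. *)
Lemma proj_eq0_step k m : (k <= ecc)%N -> (m <= ecc)%N ->
  (k == m.+1) || (m == k.+1) ->
  (forall h, (h <= k.+1)%N -> (k <= h.+1)%N -> h != m -> z h = 0) ->
  z m = 0.
Proof.
move=> k_le m_le km z0; have := proj_recurrence k_le.
rewrite (z0 k) ?leqnSn //; last by case/orP: km => /eqP->; lia.
have m_lt : (m < ecc.+1)%N by [].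
rewrite scaler0 (bigD1 (Ordinal m_lt)) //= big1 => [|h h_neq].
  move=> /esym/eqP; rewrite addr0 scaler_eq0 gt_eqF ?quotient_coef_gt0 //.
  by move/eqP.
have [far|near] := boolP ((k.+1 < h)%N || (h.+1 < k)%N).
  by rewrite quotient_coef_far ?scale0r.
by rewrite z0 ?scaler0 //; lia.
Qed.

Lemma proj_eq0_up : z 0 = 0 -> forall k, (k <= ecc)%N -> z k = 0.
Proof.
move=> z0; elim/ltn_ind => -[//|k] IHk k_lt.
apply: (proj_eq0_step (k := k)); rewrite ?eqxx ?orbT ?(ltnW k_lt) //.
by move=> h hk _ h_neq; apply: IHk; lia.
Qed.

Lemma proj_eq0_down k : (k < ecc)%N -> z k = 0 -> z k.+1 = 0 -> z 0 = 0.
Proof.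
elim: k => [//|k IHk] k_lt zk zk1; apply: IHk => //; first exact: ltnW.
apply: (proj_eq0_step (k := k.+1)); rewrite ?eqxx //; try lia.
move=> h h_le h_ge h_neq.
by have [->|->] : h = k.+1 \/ h = k.+2 by lia.
Qed.

End Quotient.

Theorem mainTheorem3 (R : rcfType) (n : nat) (e : rel 'I_n)
    (e_sym : symmetric e) (e_irr : irreflexive e)
    (e_conn : forall x y : 'I_n, connect e x y)
    (nu : 'rV[R]_n) (nu_perron : perron_vector e nu)
    (C : {set 'I_n}) (C_neq0 : C != set0)
    (C_cpr : completely_pseudo_regular e nu C)
    (k : nat) (k_lt : (k < eccentricity e C)%N) :
  ev e nu C =i [predU ev e nu (subconstituent e C k)
                    & ev e nu (subconstituent e C k.+1)].
Proof.
move=> l; have [_ _ [_ nu_gt0 _ _]] := nu_perron.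
rewrite !inE -andb_orr -negb_and !set_mult_eq0; congr (_ && ~~ _).
rewrite -{1}(subconstituent0 e_conn C_neq0).
apply/eqP/andP => [z0|[/eqP zk /eqP zk1]].
  by split; apply/eqP; apply: proj_eq0_up => //; exact: ltnW.
exact: proj_eq0_down zk zk1.
Qed.
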